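(* Let $n\ge2$, $A\in\mathcal{M}_n(\mathbb{C})$, and let $g$ be a complex polynomial with $g(0)=1$ and $\deg(g)<n-1$. Write $\sigma(A)=\bigsqcup_{r=1}^kB_r$ where for every $r$ there exist $\lambda_r\in\mathbb{C}$, $c_r\in\mathbb{N}$ with $B_r=\{\lambda_r,\lambda_r+1,\dots,\lambda_r+c_r\}$, and where $u-v\neq1$ whenever $u\in B_r$, $v\in B_s$, $r\neq s$. Let $P$ be an invertible matrix such that $P^{-1}AP=\bigoplus_{r=1}^kU_r$ is a Jordan normal form of $A$, where for every $r$, $\sigma(U_r)=B_r$ and $U_r$ is a Jordan matrix in which the eigenvalues are arranged along the diagonal in the order $\lambda_r,\lambda_r+1,\dots,\lambda_r+c_r$. Let $X\in\mathcal{M}_n(\mathbb{C})$ be a nilpotent solution of $XA-AX=Xg(X)$. Then $P^{-1}XP=\bigoplus_{s=1}^kX_s$, where for every $s$, $X_s$ is a nilpotent upper triangular matrix (of the same size as $U_s$) that satisfies $X_sU_s-U_sX_s=X_sg(X_s)$.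
   Context: $\sigma(A)$ denotes the spectrum (set of eigenvalues) of $A$. A Jordan matrix is a direct sum of Jordan blocks (upper triangular, with ones on the superdiagonal of each block). *)

(* Defs.v *)
From mathcomp Require Import all_boot all_order all_algebra.
From mathcomp Require Import reals.
From mathcomp Require Export complex.

Set Implicit Arguments.
Unset Strict Implicit.
Unset Printing Implicit Defensive.

Import GRing.Theory.
Local Open Scope ring_scope.

(* [horner_mx] exists only for sizes of the form [n.+1]; this is the same
   evaluation for square matrices of arbitrary size. *)
Definition poly_mx (F : fieldType) (n : nat) (g : {poly F}) (X : 'M[F]_n) :
  'M[F]_n := \sum_(i < size g) g`_i *: X ^+ i.

Lemma poly_mxE (F : fieldType) (n : nat) (g : {poly F}) (X : 'M[F]_n.+1) :
  poly_mx g X = horner_mx X g.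
Proof.
rewrite /poly_mx -[in RHS](coefK g) poly_def linear_sum.
by apply: eq_bigr => i _; rewrite linearZ rmorphXn /= horner_mx_X.
Qed.

Definition nilpotent_mx (F : fieldType) (n : nat) (X : 'M[F]_n) : Prop :=
  exists m : nat, X ^+ m = 0.

(* [is_trig_mx] is MathComp's predicate for lower triangular matrices. *)
Definition upper_triangular_mx (F : fieldType) (n : nat) (X : 'M[F]_n) : bool :=
  is_trig_mx X^T.

(* A direct sum of square matrices, as a matrix of size [n] when [n] is only
   propositionally equal to the sum of the block sizes. *)
Definition direct_sum_mx (F : fieldType) (n k : nat) (d : 'I_k -> nat)
    (e : (\sum_r d r = n)%N) (U : forall r, 'M[F]_(d r)) : 'M[F]_n :=
  castmx (e, e) (\mxdiag_r U r).

Definition jordan_block (F : fieldType) (m : nat) (a : F) : 'M[F]_m :=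
  \matrix_(i, j) (a *+ (i == j) + (i.+1 == j :> nat)%:R).

Definition jordan_mx (F : fieldType) (n : nat) (U : 'M[F]_n) : Prop :=
  exists (l : nat) (m : 'I_l -> nat) (a : 'I_l -> F) (e : (\sum_i m i = n)%N),
    (forall i, 0 < m i)%N /\
    U = direct_sum_mx e (fun i => jordan_block (m i) (a i)).

Definition unit_string (F : fieldType) (lam : F) (c : nat) : seq F :=
  [seq lam + j%:R | j <- iota 0 c.+1].

(* The diagonal entries of [U] occur in the order in which they are listed
   in [s], repetitions being allowed. *)
Definition diag_in_order (F : fieldType) (n : nat) (s : seq F) (U : 'M[F]_n) :
  Prop := forall i j : 'I_n, (i <= j)%N -> (index (U i i) s <= index (U j j) s)%N.

(* Main.v *)
Require Import Defs.
From mathcomp Require Import all_boot all_order all_algebra.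
From mathcomp Require Import reals.

Set Implicit Arguments.
Unset Strict Implicit.
Unset Printing Implicit Defensive.

Import Order.TTheory GRing.Theory Num.Theory.
Local Open Scope ring_scope.

(** Put [T = P^-1 A P], [Z = P^-1 X P] and [t i = T i i]. The conjugated
    equation says that the derivation [D M = M T - T M] sends [Z] to [Z g(Z)].
    As [T] is a direct sum of Jordan matrices, it is upper triangular and
    couples only indices with equal diagonal entries; hence, on the entries
    [(i, j)] with prescribed values of [t i] and [t j], the operator [D] is the
    scalar [t j - t i] plus a nilpotent part. So [D - a] can be cancelled on
    all the entries with [t j - t i <> a], the Sylvester argument of
    [supported_ad_shift].

    Since [g(0) = 1], [g(Z) = 1 + Z V] with [V] a polynomial in [Z], and
    [D (Z^q) = q Z^q g(Z)] gives [(D - q) Z^q = q Z^(q+1) V]. A descending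
    induction on [q], starting from the nilpotency of [Z], shows that [Z^q]
    lives on the entries where [t j - t i] is an integer [>= q]
    ([exp_supported_climb]). In particular [Z] lives where [t j - t i] is a
    positive integer.

    This alone does not separate the strings: between the strings [{0}] and
    [{2}] the eigenvalues also differ by a positive integer. One therefore
    shows, by induction on [k], that the nonzero entries of [Z] with
    [t j - t i < k] lie in the diagonal blocks ([supported_climb]). Indeed
    [(D - 1) Z = Z^2 V]; a nonzero entry of the right-hand side with difference
    at most [k] comes from steps of difference smaller than [k], each of them
    inside a block, and when [t j - t i = 1] the separation of the strings
    already puts [i] and [j] in the same block.

    Hence [Z] is block diagonal, and a nonzero entry inside a block goes from a
    smaller to a strictly larger place in the string of eigenvalues, which are
    listed in increasing order along the diagonal: the blocks are upper
    triangular. Nilpotency and the equation are read off block by block. *)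

(** * Matrices supported on a relation *)

(** The nonzero entries of [M] sit at positions related by [S]. *)
Definition supported (F : fieldType) (n : nat) (S : 'I_n -> 'I_n -> Prop)
  (M : 'M[F]_n) : Prop := forall i j, M i j != 0 -> S i j.

Lemma supported0 (F : fieldType) n (S : 'I_n -> 'I_n -> Prop) :
  supported S (0 : 'M[F]_n).
Proof. by move=> i j; rewrite mxE eqxx. Qed.

Lemma supportedW (F : fieldType) n (S S' : 'I_n -> 'I_n -> Prop) (M : 'M[F]_n) :
  (forall i j, S i j -> S' i j) -> supported S M -> supported S' M.
Proof. by move=> SS' SM i j /SM /SS'. Qed.

Lemma supportedZ (F : fieldType) n S a (M : 'M[F]_n) :
  supported S M -> supported S (a *: M).
Proof. by move=> SM i j; rewrite mxE mulf_eq0 negb_or => /andP[_ /SM]. Qed.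

Lemma supportedD (F : fieldType) n S (M N : 'M[F]_n) :
  supported S M -> supported S N -> supported S (M + N).
Proof.
move=> SM SN i j; rewrite mxE.
by have [->|/SM //] := eqVneq (M i j) 0; rewrite add0r => /SN.
Qed.

Lemma supported_sum (F : fieldType) n S (I : finType) (M : I -> 'M[F]_n) :
  (forall k, supported S (M k)) -> supported S (\sum_k M k).
Proof.
move=> SM; apply: big_ind => [||k _]; [exact: supported0 | exact: supportedD |].
exact: SM.
Qed.

Lemma supportedM (F : fieldType) n S S' S'' (M N : 'M[F]_n) :
  (forall i l j, S i l -> S' l j -> S'' i j) ->
  supported S M -> supported S' N -> supported S'' (M *m N).
Proof.
move=> SS SM SN i j; rewrite mxE => nz.
have /existsP[l] : [exists l, M i l * N l j != 0].
  apply: contraNT nz; rewrite negb_exists => /forallP z.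
  by rewrite big1 // => l _; apply/eqP; rewrite -[_ == _]negbK.
by rewrite mulf_eq0 negb_or => /andP[/SM iSl /SN lSj]; apply: SS iSl lSj.
Qed.

(** * Cancelling a shifted commutator with a triangular matrix *)

(** Upper triangular, with nonzero entries only between indices that carry the
    same diagonal value: the shape of a Jordan matrix, which is kept by direct
    sums whatever the order of the blocks. *)
Definition spectral_triangular (F : fieldType) (n : nat) (T : 'M[F]_n) : Prop :=
  supported (fun i j => (i <= j)%N /\ T i i = T j j) T.

(** The operator [Z |-> Z T - T Z - a Z] reflects the support in any relation
    that depends only on diagonal values and contains all the positions where
    the operator may fail to be invertible, i.e. those with
    [T j j - T i i = a]. *)
Lemma supported_ad_shift (F : fieldType) n (T Z : 'M[F]_n) (a : F)
    (S : 'I_n -> 'I_n -> Prop) :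
  spectral_triangular T ->
  (forall i i' j j', T i i = T i' i' -> T j j = T j' j' -> S i j -> S i' j') ->
  (forall i j, T j j = T i i + a -> S i j) ->
  supported S (Z *m T - T *m Z - a *: Z) -> supported S Z.
Proof.
move=> Ttri Sstable Sa SW i j.
(* The off-diagonal part of [T] moves [j] to the left and [i] down. *)
have [m] := ubnP (j + (n - i)); elim: m i j => // m IHm i j lt_m nzZ.
have [/existsP[l /andP[ne_lj]]|] :=
  boolP [exists l, (l != j) && (Z i l * T l j != 0)].
  rewrite mulf_eq0 negb_or => /andP[nz /Ttri[le_lj eq_t]].
  apply: Sstable (erefl _) eq_t _; apply: IHm nz.
  have lt_lj : (l < j)%N by rewrite ltn_neqAle ne_lj.
  by rewrite -ltnS; apply: leq_trans lt_m; rewrite ltnS -addSn leq_add2r.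
rewrite negb_exists => /forallP right0.
have [/existsP[l /andP[ne_li]]|] :=
  boolP [exists l, (l != i) && (T i l * Z l j != 0)].
  rewrite mulf_eq0 negb_or => /andP[/Ttri[le_il eq_t] nz].
  apply: Sstable (esym eq_t) (erefl _) _; apply: IHm nz.
  have lt_il : (i < l)%N by rewrite ltn_neqAle eq_sym ne_li.
  by rewrite -ltnS; apply: leq_trans lt_m; rewrite ltnS -addnS leq_add2l ltn_sub2l.
rewrite negb_exists => /forallP left0.
have [/Sa //|ne_a] := eqVneq (T j j) (T i i + a).
(* Only the diagonal of [T] contributes, and the entry of the left-hand side
   is [(T j j - T i i - a) * Z i j]. *)
apply: SW; rewrite !mxE (bigD1 j) //= [X in _ - X - _](bigD1 i) //=.
rewrite !big1 => [|l ne_l|l ne_l].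
- rewrite !addr0 [Z i j * _]mulrC -!mulrBl mulf_neq0 //.
  by rewrite -addrA -opprD subr_eq0.
- by have := left0 l; rewrite ne_l /= negbK => /eqP.
- by have := right0 l; rewrite ne_l /= negbK => /eqP.
Qed.

(** * Positions that climb along the eigenvalues *)

(** From [i] to [j] the value of [t] climbs by an integer [q >= p]; moreover [i]
    and [j] have the same label under [b] (their block) if [q < k]. Thus
    [k = 0] puts no constraint on the labels. *)
Definition climb (F : fieldType) (n : nat) (I : Type) (t : 'I_n -> F)
    (b : 'I_n -> I) (p k : nat) (i j : 'I_n) : Prop :=
  exists q, [/\ (p <= q)%N, t j = t i + q%:R & (q < k)%N -> b i = b j].

Section Climb.

Context {F : fieldType} {n : nat} {I : Type} (t : 'I_n -> F) (b : 'I_n -> I).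
Context (bt : forall i j, t i = t j -> b i = b j).

Lemma climbW p p' k i j : (p' <= p)%N -> climb t b p k i j -> climb t b p' k i j.
Proof. by move=> le_p [q [le_q]]; exists q; split=> //; apply: leq_trans le_q. Qed.

Lemma climb_stable p k i i' j j' : t i = t i' -> t j = t j' ->
  climb t b p k i j -> climb t b p k i' j'.
Proof.
move=> ti tj [q [le_q eq_t eq_b]]; exists q; split; rewrite -?ti -?tj //.
by move=> /eq_b; rewrite (bt ti) (bt tj).
Qed.

Lemma climb_trans p p' k i l j :
  climb t b p k i l -> climb t b p' k l j -> climb t b (p + p') k i j.
Proof.
move=> [q [le_q tq bq]] [q' [le_q' tq' bq']]; exists (q + q')%N.
split; first exact: leq_add.
  by rewrite tq' tq natrD addrA.
move=> lt_k; rewrite bq ?bq' //; apply: leq_ltn_trans lt_k.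
  exact: leq_addl.
exact: leq_addr.
Qed.

(** Composing two nonzero climbs gains one unit in [k]: each of the two is
    strictly smaller than their sum. *)
Lemma climb_transS k i l j :
  climb t b 1 k i l -> climb t b 1 k l j -> climb t b 1 k.+1 i j.
Proof.
move=> [q [q0 tq bq]] [q' [q0' tq' bq']]; exists (q + q')%N.
split; first by rewrite addn_gt0 q0.
  by rewrite tq' tq natrD addrA.
rewrite ltnS => le_k; rewrite bq ?bq' //; apply: leq_trans le_k.
  by rewrite -[q'.+1]add1n leq_add2r.
by rewrite -[q.+1]addn1 leq_add2l.
Qed.

Lemma supported_climb_exp k (Z : 'M[F]_n) m :
  supported (climb t b 1 k) Z -> supported (climb t b 0 k) (Z ^+ m).
Proof.
move=> SZ; elim: m => [|m IHm].
  move=> i j; rewrite expr0 mxE; have [<- _|_] := eqVneq i j; last by rewrite eqxx.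
  by exists 0; rewrite addr0.
rewrite exprS; apply: supportedM SZ IHm => i l j il lj.
exact: climbW (climb_trans il lj).
Qed.

End Climb.

(** * Support of the nilpotent solutions *)

Lemma poly_mx_recl (F : fieldType) n (g : {poly F}) (Z : 'M[F]_n) : g.[0] = 1 ->
  poly_mx g Z = 1 + Z *m \sum_(i < (size g).-1) g`_i.+1 *: Z ^+ i.
Proof.
move=> g0; have : (0 < size g)%N.
  rewrite lt0n size_poly_eq0; apply: contra_eq_neq g0 => ->.
  by rewrite horner0 eq_sym oner_neq0.
rewrite /poly_mx; case: (size g) => // m _.
rewrite big_ord_recl expr0 -horner_coef0 g0 scale1r mulmx_sumr; congr (_ + _).
by apply: eq_bigr => i _; rewrite -scalemxAr exprS.
Qed.

Lemma commutator_exp (F : fieldType) n (Z T W : 'M[F]_n) m :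
  Z *m W = W *m Z -> Z *m T - T *m Z = Z *m W ->
  Z ^+ m *m T - T *m Z ^+ m = m%:R *: (Z ^+ m *m W).
Proof.
move=> ZW ZT; elim: m => [|m IHm].
  by rewrite expr0 scale0r mulmx1 mul1mx subrr.
have WZm : Z ^+ m *m W = W *m Z ^+ m.
  elim: m {IHm} => [|m IHm]; first by rewrite expr0 mul1mx mulmx1.
  by rewrite exprS -mulmxA IHm !mulmxA ZW.
have -> : Z ^+ m.+1 *m T - T *m Z ^+ m.+1 =
    Z *m (Z ^+ m *m T - T *m Z ^+ m) + (Z *m T - T *m Z) *m Z ^+ m.
  by rewrite exprS -mulmxE mulmxBr mulmxBl !mulmxA addrA subrK.
rewrite IHm ZT -scalemxAr -mulmxA -WZm -natr1 scalerDl scale1r.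
by rewrite exprS -mulmxE mulmxA.
Qed.

Lemma poly_mx_comm (F : fieldType) n (g : {poly F}) (Z : 'M[F]_n) :
  Z *m poly_mx g Z = poly_mx g Z *m Z.
Proof.
rewrite /poly_mx mulmx_sumr mulmx_suml; apply: eq_bigr => i _.
by rewrite -scalemxAr -scalemxAl; congr (_ *: _); rewrite -[LHS]exprS exprSr.
Qed.

(** By descending induction on [q], as [Z ^+ q = 0] for large [q] and
    [(D - q) (Z ^+ q)] is a combination of higher powers of [Z], where
    [D M = M T - T M]. *)
Lemma exp_supported_climb (F : fieldType) n (I : Type) (b : 'I_n -> I)
    (T Z : 'M[F]_n) (g : {poly F}) q :
  spectral_triangular T -> g.[0] = 1 -> nilpotent_mx Z ->
  (forall i j, T i i = T j j -> b i = b j) ->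
  Z *m T - T *m Z = Z *m poly_mx g Z ->
  supported (climb (fun i => T i i) b q 0) (Z ^+ q).
Proof.
move=> Ttri g0 [m Zm0] bt ZT.
have [d] := ubnP (m - q); elim: d q => // d IHd q lt_d.
have [le_mq|lt_qm] := leqP m q.
  by rewrite -(subnK le_mq) exprD Zm0 mulr0; apply: supported0.
apply: (@supported_ad_shift _ _ T _ q%:R _ Ttri).
- by move=> i i' j j'; apply: (climb_stable (t := fun i => T i i) bt).
- by move=> i j eq_t; exists q.
rewrite (commutator_exp _ (poly_mx_comm g Z) ZT) (poly_mx_recl Z g0) mulmxDr.
rewrite scalerDr mulmx1 addrAC subrr add0r mulmxA mulmx_sumr.
apply: supportedZ; apply: supported_sum => i.
rewrite -scalemxAr; apply: supportedZ.
have -> : Z ^+ q *m Z *m Z ^+ i = Z ^+ (q.+1 + i).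
  by rewrite mulmxE -exprSr -exprD.
apply: supportedW (IHd _ _) => [i' j'|].
  by apply: climbW; rewrite addSn (leq_trans (leq_addr i q)).
apply: leq_trans (_ : m - q <= d)%N; last by rewrite -ltnS.
by rewrite ltn_sub2l // addSn ltnS leq_addr.
Qed.

(** By induction on [k], as [(D - 1) Z] is [Z *m Z] times a polynomial in [Z],
    where [D M = M T - T M]. *)
Lemma supported_climb (F : fieldType) n (I : Type) (b : 'I_n -> I)
    (T Z : 'M[F]_n) (g : {poly F}) k :
  spectral_triangular T -> g.[0] = 1 -> nilpotent_mx Z ->
  (forall i j, T i i = T j j -> b i = b j) ->
  (forall i j, T j j = T i i + 1 -> b i = b j) ->
  Z *m T - T *m Z = Z *m poly_mx g Z ->
  supported (climb (fun i => T i i) b 1 k) Z.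
Proof.
move=> Ttri g0 nilZ bt bt1 ZT; elim: k => [|k IHk].
  by rewrite -[Z]expr1; apply: exp_supported_climb ZT.
apply: (@supported_ad_shift _ _ T _ 1 _ Ttri).
- by move=> i i' j j'; apply: (climb_stable (t := fun i => T i i) bt).
(* On the entries where [D - 1] is not invertible the labels agree. *)
- by move=> i j eq_t; exists 1; split=> // _; apply: bt1.
rewrite ZT (poly_mx_recl Z g0) mulmxDr mulmx1 scale1r addrAC subrr add0r.
apply: (supportedM (@climb_transS _ _ _ _ _ k) IHk).
apply: (supportedM (@climb_trans _ _ _ _ _ 1 0 k) IHk).
apply: supported_sum => i; apply: supportedZ.
exact: supported_climb_exp IHk.
Qed.

(** Here characteristic zero is used: it makes the integer [T j j - T i i] well
    defined, so that [supported_climb] may be applied with [k] beyond it. *)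
Lemma nilpotent_solution_support (F : numFieldType) n (I : Type) (b : 'I_n -> I)
    (T Z : 'M[F]_n) (g : {poly F}) :
  spectral_triangular T -> g.[0] = 1 -> nilpotent_mx Z ->
  (forall i j, T i i = T j j -> b i = b j) ->
  (forall i j, T j j = T i i + 1 -> b i = b j) ->
  Z *m T - T *m Z = Z *m poly_mx g Z ->
  supported
    (fun i j => b i = b j /\ exists2 q, (0 < q)%N & T j j = T i i + q%:R) Z.
Proof.
move=> Ttri g0 nilZ bt bt1 ZT i j nzZ.
have SZ k := supported_climb k Ttri g0 nilZ bt bt1 ZT nzZ.
have [q [q0 tq _]] := SZ 0; have [q' [_ tq' bq']] := SZ q.+1.
split; last by exists q.
by apply: bq'; move: tq'; rewrite tq => /addrI/eqP; rewrite eqr_nat => /eqP->.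
Qed.

(** * Direct sums, Jordan matrices and conjugation *)

Lemma mxdiag_Rank (F : fieldType) k (d : 'I_k -> nat)
    (U : forall r, 'M[F]_(d r)) r (i j : 'I_(d r)) :
  (\mxdiag_s U s) (tagnat.Rank r i) (tagnat.Rank r j) = U r i j.
Proof. by rewrite -[in RHS](submxblock_diag U r) !mxE. Qed.

Lemma mxdiag_sig (F : fieldType) k (d : 'I_k -> nat)
    (U : forall r, 'M[F]_(d r)) i :
  (\mxdiag_s U s) i i =
    U (tagnat.sig1 i) (tagnat.sig2 i) (tagnat.sig2 i).
Proof. by rewrite -[in LHS](tagnat.sig2K i) mxdiag_Rank. Qed.

Lemma spectral_triangular_mxdiag (F : fieldType) k (d : 'I_k -> nat)
    (U : forall r, 'M[F]_(d r)) :
  (forall r, spectral_triangular (U r)) ->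
  spectral_triangular (\mxdiag_r U r).
Proof.
move=> Utri i j nzij.
have [eq_b|ne_b] := eqVneq (tagnat.sig1 i) (tagnat.sig1 j); last first.
  by move: nzij; rewrite mxE (negPf ne_b) mxE eqxx.
move: nzij; rewrite -(tagnat.sig2K i) -(tagnat.sig2K j).
move: (tagnat.sig2 i) (tagnat.sig2 j); rewrite eq_b => x y.
rewrite !mxdiag_Rank => /Utri[le_xy ->]; split=> //.
by have := tagnat.le_Rank x y; rewrite !leEord le_xy.
Qed.

Lemma direct_sum_mx_erefl (F : fieldType) k (d : 'I_k -> nat)
    (U : forall r, 'M[F]_(d r)) :
  direct_sum_mx (erefl (\sum_r d r)%N) U = \mxdiag_r U r.
Proof. exact: castmx_id. Qed.

Lemma spectral_triangular_jordan (F : fieldType) n (U : 'M[F]_n) :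
  jordan_mx U -> spectral_triangular U.
Proof.
case=> l [m [a [e [_ ->]]]]; case: _ / e; rewrite direct_sum_mx_erefl.
apply: spectral_triangular_mxdiag => r i j; rewrite !mxE !eqxx !mulr1n.
have nS (x : nat) : (x.+1 == x) = false by apply: gtn_eqF.
rewrite !nS !addr0.
have [->|ne] := eqVneq i j; first by rewrite leqnn.
rewrite mulr0n add0r; have [<- _|_] := eqVneq i.+1 (j : nat).
  by rewrite leqnSn.
by rewrite eqxx.
Qed.

Lemma diag_eigenvalue (F : fieldType) n (U : 'M[F]_n) i :
  spectral_triangular U -> eigenvalue U (U i i).
Proof.
move=> Utri; rewrite eigenvalue_root_char.
have -> : char_poly U = char_poly U^T.
  rewrite /char_poly -det_tr; congr (\det _); apply/matrixP => j l.
  by rewrite !mxE eq_sym.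
rewrite char_poly_trig; last first.
  apply/is_trig_mxP => j l lt_jl; rewrite mxE; apply/eqP.
  by apply: contraTT lt_jl => /Utri[le_lj _]; rewrite -leqNgt.
apply/rootP; rewrite horner_prod (bigD1 i) //= !mxE !hornerE subrr.
by rewrite mul0r.
Qed.

Lemma mxdiagM (F : fieldType) k (d : 'I_k -> nat) (U V : forall r, 'M[F]_(d r)) :
  (\mxdiag_r U r) *m (\mxdiag_r V r) = \mxdiag_r (U r *m V r).
Proof.
rewrite [in LHS]/mxdiag mul_mxblock_mxdiag; apply: eq_mxblock => i j.
by case: eqVneq => [<-|_]; rewrite ?conform_mx_id ?mul0mx.
Qed.

Lemma mxdiag_scale (F : fieldType) k (d : 'I_k -> nat) a
    (U : forall r, 'M[F]_(d r)) :
  a *: (\mxdiag_r U r) = \mxdiag_r (a *: U r).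
Proof.
rewrite -mul_scalar_mx -mxdiagZ mxdiagM; apply: eq_mxdiag => r.
by rewrite mul_scalar_mx.
Qed.

Lemma mxdiag_exp (F : fieldType) k (d : 'I_k -> nat)
    (U : forall r, 'M[F]_(d r)) m :
  (\mxdiag_r U r) ^+ m = \mxdiag_r (U r ^+ m).
Proof.
elim: m => [|m IHm].
  by rewrite expr0 -[1]/(1%:M) -mxdiagZ; apply: eq_mxdiag.
by rewrite exprS IHm -mulmxE mxdiagM; apply: eq_mxdiag => r; rewrite exprS.
Qed.

Lemma poly_mx_mxdiag (F : fieldType) k (d : 'I_k -> nat) (g : {poly F})
    (U : forall r, 'M[F]_(d r)) :
  poly_mx g (\mxdiag_r U r) = \mxdiag_r poly_mx g (U r).
Proof.
rewrite /poly_mx mxdiag_sum; apply: eq_bigr => i _.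
by rewrite mxdiag_exp mxdiag_scale.
Qed.

Lemma supported_mxdiag (F : fieldType) k (d : 'I_k -> nat)
    (Z : 'M[F]_(\sum_r d r)) :
  supported (fun i j => tagnat.sig1 i = tagnat.sig1 j) Z ->
  Z = \mxdiag_r submxblock Z r r.
Proof.
move=> SZ; rewrite -[LHS]submxblockK; apply: eq_mxblock => r s.
have [<-|ne_rs] := eqVneq r s; first by rewrite conform_mx_id.
apply/matrixP => i j; rewrite !mxE; apply/eqP.
apply: contraTT (ne_rs) => /SZ; rewrite !tagnat.Rank1K => ->.
by rewrite eqxx.
Qed.

Section Conjugation.

Context {F : fieldType} {n : nat} (P : 'M[F]_n).
Context (Punit : P \in unitmx).

Let conj (M : 'M[F]_n) := invmx P *m M *m P.

Lemma conjM M N : conj (M *m N) = conj M *m conj N.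
Proof. by rewrite /conj !mulmxA mulmxK. Qed.

Lemma conjB M N : conj (M - N) = conj M - conj N.
Proof. by rewrite /conj mulmxBr mulmxBl. Qed.

Lemma conj_exp M m : conj M ^+ m = conj (M ^+ m).
Proof.
elim: m => [|m IHm]; first by rewrite !expr0 /conj mulmx1 mulVmx.
by rewrite !exprS IHm -!mulmxE conjM.
Qed.

Lemma conj_poly_mx g M : poly_mx g (conj M) = conj (poly_mx g M).
Proof.
rewrite /poly_mx /conj mulmx_sumr mulmx_suml; apply: eq_bigr => i _.
by rewrite -/(conj M) conj_exp /conj -scalemxAr -scalemxAl.
Qed.

End Conjugation.

(** * Strings of eigenvalues *)

Lemma unit_stringP (F : numFieldType) (lam z : F) c :
  reflect (exists2 a, (a <= c)%N & z = lam + a%:R) (z \in unit_string lam c).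
Proof.
apply: (iffP mapP) => -[a le_a ->]; exists a => //.
  by move: le_a; rewrite mem_iota.
by rewrite mem_iota.
Qed.

Lemma index_unit_string (F : numFieldType) (lam : F) c a : (a <= c)%N ->
  index (lam + a%:R) (unit_string lam c) = a.
Proof.
move=> le_a; rewrite (index_map (f := fun j => lam + j%:R)).
  have nth_a : nth 0%N (iota 0 c.+1) a = a by rewrite nth_iota.
  by rewrite -[in LHS]nth_a index_uniq ?size_iota ?iota_uniq.
by move=> x y /addrI/eqP; rewrite eqr_nat => /eqP.
Qed.

Theorem theorem6 (R : realType) (n : nat) (A : 'M[R[i]]_n) (g : {poly R[i]})
    (k : nat) (lam : 'I_k -> R[i]) (c : 'I_k -> nat)
    (d : 'I_k -> nat) (e : (\sum_r d r = n)%N)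
    (P : 'M[R[i]]_n) (U : forall r : 'I_k, 'M[R[i]]_(d r))
    (X : 'M[R[i]]_n) :
  let B := fun r : 'I_k => unit_string (lam r) (c r) in
  (2 <= n)%N ->
  g.[0] = 1 -> ((size g).-1 < n - 1)%N ->
  (forall z, eigenvalue A z <-> exists r, z \in B r) ->
  (forall r s z, z \in B r -> z \in B s -> r = s) ->
  (forall r s u v, u \in B r -> v \in B s -> r <> s -> u - v <> 1) ->
  P \in unitmx ->
  invmx P *m A *m P = direct_sum_mx e U ->
  (forall r, jordan_mx (U r)) ->
  (forall r, eigenvalue (U r) =i B r) ->
  (forall r, diag_in_order (B r) (U r)) ->
  nilpotent_mx X ->
  X *m A - A *m X = X *m poly_mx g X ->
  exists X_ : forall s : 'I_k, 'M[R[i]]_(d s),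
    invmx P *m X *m P = direct_sum_mx e X_ /\
    forall s, [/\ nilpotent_mx (X_ s),
                  upper_triangular_mx (X_ s) &
                  X_ s *m U s - U s *m X_ s = X_ s *m poly_mx g (X_ s)].
Proof.
move=> B _ g0 _ _ disj sep Punit PAP Ujordan eigU ordU [m Xm0] XA.
(* The size [n] is replaced by the sum of the block sizes. *)
case: _ / e A P X Punit PAP Xm0 XA => A P X Punit.
rewrite direct_sum_mx_erefl; set T := \mxdiag_r U r => PAP Xm0 XA.
set Z := invmx P *m X *m P.
have Utri r := spectral_triangular_jordan (Ujordan r).
have TB i : T i i \in B (tagnat.sig1 i).
  by rewrite /T mxdiag_sig -eigU; apply: diag_eigenvalue.
have ZT : Z *m T - T *m Z = Z *m poly_mx g Z.
  by rewrite -PAP conj_poly_mx // -!conjM // -conjB XA.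
have nilZ : nilpotent_mx Z.
  by exists m; rewrite conj_exp // Xm0 mulmx0 mul0mx.
clearbody Z.
have SZ : supported (fun i j => tagnat.sig1 i = tagnat.sig1 j /\
    exists2 q, (0 < q)%N & T j j = T i i + q%:R) Z.
  apply: nilpotent_solution_support ZT => //.
  - exact: spectral_triangular_mxdiag.
  - by move=> i j eq_t; apply: disj (TB i) _; rewrite eq_t.
  move=> i j eq_t; apply/eqP; apply: contraT => /eqP ne_b.
  by case: (sep _ _ _ _ (TB j) (TB i)); rewrite ?eq_t 1?addrC ?addKr //; apply/nesym.
have Zdiag : Z = \mxdiag_r submxblock Z r r.
  by apply: supported_mxdiag => i j /SZ[].
exists (fun r => submxblock Z r r); split; first by rewrite direct_sum_mx_erefl.
move=> s; split.
- case: nilZ => p Zp0; exists p; move: Zp0.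
  rewrite {1}Zdiag mxdiag_exp -[0](mxdiag0 (p_ := d)).
  by move/eq_mxdiagP; apply.
- rewrite /upper_triangular_mx; apply/is_trig_mxP => i j lt_ij.
  rewrite !mxE; apply/eqP.
  apply: contraTT (lt_ij) => /SZ[_ [q q0]].
  rewrite /T !mxdiag_Rank => eq_t.
  have /unit_stringP[a le_a Uj] : U s j j \in B s.
    by rewrite -eigU; apply: diag_eigenvalue.
  have /unit_stringP[a' le_a' Ui] : U s i i \in B s.
    by rewrite -eigU; apply: diag_eigenvalue.
  (* The order of the diagonal gives [a' <= a], while [a' = a + q] with [q > 0]. *)
  have := ordU s i j (ltnW lt_ij).
  rewrite Ui Uj !index_unit_string //.
  move: eq_t; rewrite Ui Uj -addrA -natrD => /addrI/eqP; rewrite eqr_nat.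
  by move=> /eqP->; rewrite leqNgt -[X in (X < _)%N]addn0 ltn_add2l q0.
- move: ZT; rewrite {1 2 3 4}Zdiag /T poly_mx_mxdiag !mxdiagM -mxdiagB.
  by move/eq_mxdiagP; apply.
Qed.
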